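(* Let $n\ge 2$, let $\mathbf{A}$ be a degenerate $(n+1)$-simplex in $\mathbb{R}^n$ with non-degenerate $n$-faces, and let $\mathbf{B}$ be a dual of $\mathbf{A}$ in $\mathbb{R}^n$. Let $\alpha$ be a $1$-stress on $\mathbf{A}$ and $\beta$ a $1$-stress on $\mathbf{B}$, and let $f(x)$ and $g(x)$ be the characteristic polynomials of $(\mathbf{A},\alpha)$ and $(\mathbf{B},\beta)$ respectively. If the non-zero roots of $f(x)$ (with multiplicity) are $\{\lambda_1,\dots,\lambda_n\}$, then the non-zero roots of $g(x)$ (with multiplicity) are $\{c/\lambda_1,\dots,c/\lambda_n\}$ for some constant $c$.
   Context: A degenerate $(n+1)$-simplex $\mathbf{A}$ in $\mathbb{R}^n$ (with non-degenerate $n$-faces) is given by $n+2$ points (vertices) $A_1,\dots,A_{n+2}\in\mathbb{R}^n$ any $n+1$ of which are affinely independent. A $1$-stress on $\mathbf{A}$ is a sequence $\alpha=\{\alpha_1,\dots,\alpha_{n+2}\}$ of non-zero reals with $\sum\alpha_iA_i=0$ and $\sum\alpha_i=0$; it exists and is unique up to a constant factor. Dual: a degenerate $(n+1)$-simplex $\mathbf{B}$ in $\mathbb{R}^n$ (with non-degenerate $n$-faces) with vertices $B_1,\dots,B_{n+2}$ is called a dual of $\mathbf{A}$ if $\overrightarrow{A_iA_j}\cdot\overrightarrow{B_kB_l}=0$ for all distinct $i,j,k,l\in\{1,\dots,n+2\}$. Stress invariants (Euclidean case): $c_0(\alpha^0)=1$, and for $1\le k\le n+1$ $$c_k(\alpha^k)=\sum_{S\subset\{1,\dots,n+2\},\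 |S|=k}\Big(\prod_{s\in S}\alpha_s\Big)\det\big(\overrightarrow{PA_s}\cdot\overrightarrow{QA_t}\big)_{s,t\in S},$$ for any points $P,Q\in\mathbb{R}^n$; the value does not depend on the choice of $P,Q$. The invariants $c_k(\beta^k)$ are defined in the same way from the points $B_i$ and the $1$-stress $\beta$ on $\mathbf{B}$. The characteristic polynomial of $(\mathbf{A},\alpha)$ is $f(x)=\sum_{i=0}^{n+1}(-1)^ic_i(\alpha^i)x^{n+1-i}$, and that of $(\mathbf{B},\beta)$ is $g(x)=\sum_{i=0}^{n+1}(-1)^ic_i(\beta^i)x^{n+1-i}$. It is known that such a polynomial has exactly one zero root and $n$ non-zero (real) roots, counted with multiplicity. *)

(* Defs.v *)
From HB Require Import structures.
From mathcomp Require Import all_boot all_order all_algebra.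
From mathcomp Require Import reals.

Set Implicit Arguments.
Unset Strict Implicit.
Unset Printing Implicit Defensive.

Import Order.TTheory GRing.Theory Num.Theory.
Local Open Scope ring_scope.

Definition dot (R : realType) (n : nat) (u v : 'rV[R]_n) : R :=
  \sum_(i < n) u 0 i * v 0 i.

Definition affinely_independent (R : realType) (m n : nat)
    (A : 'I_m -> 'rV[R]_n) (S : {set 'I_m}) : Prop :=
  forall w : 'I_m -> R,
    \sum_(i in S) w i = 0 -> \sum_(i in S) w i *: A i = 0 ->
    forall i, i \in S -> w i = 0.

(* Degeneracy is automatic: these are n + 2 points in a space of dimension n. *)
Definition degenerate_simplex (R : realType) (n : nat)
    (A : 'I_n.+2 -> 'rV[R]_n) : Prop :=
  forall S : {set 'I_n.+2}, #|S| = n.+1 -> affinely_independent A S.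

Definition one_stress (R : realType) (n : nat)
    (A : 'I_n.+2 -> 'rV[R]_n) (alpha : 'I_n.+2 -> R) : Prop :=
  [/\ forall i, alpha i != 0,
      \sum_i alpha i *: A i = 0
    & \sum_i alpha i = 0].

Definition dual (R : realType) (n : nat) (A B : 'I_n.+2 -> 'rV[R]_n) : Prop :=
  degenerate_simplex B /\
  forall i j k l : 'I_n.+2, uniq [:: i; j; k; l] ->
    dot (A j - A i) (B l - B k) = 0.

(* The base points P and Q are explicit parameters; on a 1-stress the value
   does not depend on them. *)
Definition stress_inv (R : realType) (n : nat) (A : 'I_n.+2 -> 'rV[R]_n)
    (alpha : 'I_n.+2 -> R) (P Q : 'rV[R]_n) (k : nat) : R :=
  \sum_(S : {set 'I_n.+2} | #|S| == k)
    (\prod_(s in S) alpha s) *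
    \det (\matrix_(i < #|S|, j < #|S|)
            dot (A (enum_val i) - P) (A (enum_val j) - Q)).

Lemma stress_inv0 (R : realType) (n : nat) (A : 'I_n.+2 -> 'rV[R]_n)
    (alpha : 'I_n.+2 -> R) (P Q : 'rV[R]_n) :
  stress_inv A alpha P Q 0 = 1.
Proof.
rewrite /stress_inv (big_pred1 set0) => [|S]; last by rewrite cards_eq0.
rewrite big_set0 mul1r; move: (fun _ _ => _); rewrite cards0 => F.
exact: det_mx00.
Qed.

Definition stress_char_poly (R : realType) (n : nat) (A : 'I_n.+2 -> 'rV[R]_n)
    (alpha : 'I_n.+2 -> R) (P Q : 'rV[R]_n) : {poly R} :=
  \sum_(i < n.+2) ((-1) ^+ i * stress_inv A alpha P Q i) *: 'X^(n.+1 - i).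

(* s lists the non-zero roots of p, each repeated according to its
   multiplicity. *)
Definition nonzero_roots (R : realType) (p : {poly R}) (s : seq R) : Prop :=
  0 \notin s /\ forall x : R, x != 0 -> count_mem x s = mup x p.

(* Main.v *)
Require Import Defs.
From HB Require Import structures.
From mathcomp Require Import all_boot all_order all_algebra.
From mathcomp Require Import reals perm.
From mathcomp Require Import ring.

Set Implicit Arguments.
Unset Strict Implicit.
Unset Printing Implicit Defensive.

Import Order.TTheory GRing.Theory Num.Theory.
Local Open Scope ring_scope.

(** The stress invariants are sums of principal minors, so [stress_char_poly] is
    a characteristic polynomial in disguise.  Write [A] also for the matrix whose
    rows are the vertices, [1] for the column of ones and [D] for
    the diagonal matrix of the stress [alpha].  The principal minors of
    [D (A - 1 P) (A - 1 Q)^T], of size [n + 2], are the summands of the [c_k]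
    ([char_poly_principal_minors]).  Exchanging the two factors
    ([char_poly_mulmxC]) replaces this matrix by [(A - 1 Q)^T D (A - 1 P)], which
    is of size [n] and, because [alpha] is an affine dependence, equals
    [M_A = A^T D A].  Hence [f = 'X * char_poly M_A] ([stress_char_polyE]), and
    likewise [g = 'X * char_poly M_B].

    Duality says that the matrix [A B^T] of scalar products, off its diagonal, is
    a sum of a function of the row and a function of the column
    ([off_diagonal_decomposition]): [A B^T = u 1^T + 1 v + E] with [E] diagonal.
    Multiplying by the stress [alpha] on the left kills [A B^T] and [1 v], which
    forces [D_alpha E] to be a scalar matrix [k]; in the same way [E D_beta] is a
    scalar matrix [k'].  The rank one terms disappear between [A^T D_alpha] and
    [D_beta B], so that [M_A M_B = A^T D_alpha E D_beta B = k (A^T D_beta B)].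
    Finally [B (A^T D_beta B) = k' B] up to a matrix whose columns are constant,
    and as the points of [B] span the space affinely, [A^T D_beta B = k'].  So
    [M_A M_B] is the scalar [c = k k'] ([stress_form_mul]).

    It follows that the eigenvalues of [M_B] are the [c / l] for [l] an eigenvalue
    of [M_A] ([char_poly_scalar_inverse]), and [c] is not zero because [M_A] and
    [M_B] are invertible: the former has the non-zero eigenvalues [lambda], the latter
    is treated in [stress_form_unit]. *)

(** * Characteristic polynomials and principal minors *)

(** The sizes [p] and [m] are kept apart so that [p] may be a sum of two
    cardinals, which gives the reindexed matrix a block structure. *)
Lemma det_mxsub_bij (R : comPzRingType) (p m : nat) (f : 'I_p -> 'I_m)
    (M : 'M[R]_m) :
  p = m -> injective f -> \det (mxsub f f M) = \det M.
Proof.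
move=> epm; case: m / epm f M => f M f_inj.
have -> : mxsub f f M = perm_mx (perm f_inj) *m M *m (perm_mx (perm f_inj))^T.
  rewrite tr_perm_mx -row_permE -col_permE.
  by apply/matrixP => i j; rewrite !mxE !permE.
by rewrite !det_mulmx det_tr det_perm mulrAC -signr_addb addbb mul1r.
Qed.

Definition principal_submx (R : Type) (m : nat) (S : {set 'I_m}) (M : 'M[R]_m) :
    'M[R]_#|S| :=
  mxsub (@enum_val _ (mem S)) (@enum_val _ (mem S)) M.

(** Listing the indices of [S] before the others makes this matrix block
    triangular, with a scalar block in the lower right corner. *)
Lemma det_rows_principal (R : comPzRingType) (m : nat) (S : {set 'I_m}) (d : R)
    (M : 'M[R]_m) :
  \det (\matrix_(i, j) (if i \in S then M i j else (d%:M : 'M_m) i j)) =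
    d ^+ (m - #|S|) * \det (principal_submx S M).
Proof.
set K := \matrix_(i, j) _.
pose f (i : 'I_(#|S| + #|~: S|)) : 'I_m :=
  match split i with inl j => enum_val j | inr j => enum_val j end.
have cardS : (#|S| + #|~: S| = m)%N by rewrite cardsC card_ord.
have f_inj : injective f.
  move=> i j; rewrite /f.
  case: (split_ordP i) => i' ->; case: (split_ordP j) => j' ->;
    rewrite ?(unsplitK (inl _)) ?(unsplitK (inr _)).
  - by move=> /enum_val_inj ->.
  - by move=> eq_ij; have := enum_valP j'; rewrite -eq_ij inE enum_valP.
  - by move=> eq_ij; have := enum_valP i'; rewrite eq_ij inE enum_valP.
  - by move=> /enum_val_inj ->.
rewrite -(det_mxsub_bij K cardS f_inj).
have -> : mxsub f f K = block_mx (principal_submx S M)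
    (\matrix_(i, j) M (enum_val i) (enum_val j)) 0 d%:M.
  apply/matrixP => i j; rewrite [LHS]mxE [LHS]mxE /f.
  case: (split_ordP i) => i' ->; case: (split_ordP j) => j' ->;
    rewrite ?(block_mxEul, block_mxEur, block_mxEdl, block_mxEdr)
            ?(unsplitK (inl _)) ?(unsplitK (inr _)).
  - by rewrite enum_valP !mxE.
  - by rewrite enum_valP !mxE.
  - have := enum_valP i'; rewrite inE => /negPf iS.
    rewrite iS !mxE; case: eqP => // eq_ij.
    by rewrite eq_ij enum_valP in iS.
  - have := enum_valP i'; rewrite inE => /negPf ->.
    by rewrite !mxE (inj_eq enum_val_inj).
rewrite det_ublock det_scalar mulrC; congr (_ ^+ _ * _).
by rewrite [LHS]cardsCs setCK card_ord.
Qed.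

(** Multilinearity in the rows: [S] is the set of rows taken from [M], the other
    rows being taken from the scalar matrix. *)
Lemma det_scalar_add (R : comPzRingType) (m : nat) (d : R) (M : 'M[R]_m) :
  \det (d%:M + M) = \sum_(S : {set 'I_m}) d ^+ (m - #|S|) * \det (principal_submx S M).
Proof.
under [RHS]eq_bigr => S _ do rewrite -det_rows_principal.
rewrite exchange_big; apply: eq_bigr => s _ /=.
rewrite -mulr_sumr; congr (_ * _).
under eq_bigr => i _ do rewrite mxE addrC.
rewrite bigA_distr; apply: eq_bigr => S _.
by apply: eq_bigr => i _; rewrite [RHS]mxE.
Qed.

Lemma char_poly_principal_minors (R : comNzRingType) (m : nat) (M : 'M[R]_m) :
  char_poly M =
    \sum_(S : {set 'I_m}) ((-1) ^+ #|S| * \det (principal_submx S M)) *: 'X^(m - #|S|).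
Proof.
rewrite /char_poly /char_poly_mx det_scalar_add; apply: eq_bigr => S _.
have -> : principal_submx S (- map_mx polyC M) =
    (-1) *: map_mx polyC (principal_submx S M).
  by apply/matrixP => i j; rewrite !mxE mulN1r.
by rewrite detZ det_map_mx -mul_polyC mulrC polyCM polyC_exp polyCN.
Qed.

(** Both sides come from the block matrix with rows [(X, u)] and [(v, 1)],
    reduced by column operations on the left and by row operations on the right. *)
Lemma char_poly_mulmxC (R : comNzRingType) (m n : nat) (U : 'M[R]_(m, n))
    (V : 'M[R]_(n, m)) :
  'X^n * char_poly (U *m V) = 'X^m * char_poly (V *m U).
Proof.
rewrite /char_poly /char_poly_mx !map_mxM.
move: (map_mx _ U) (map_mx _ V) => u v.
set K := block_mx ('X%:M : 'M_m) u v (1%:M : 'M_n).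
have detK : \det K = \det ('X%:M - u *m v).
  have -> : \det K = \det (K *m block_mx 1%:M 0 (- v) 1%:M).
    by rewrite det_mulmx det_lblock !det1 !mulr1.
  by rewrite mulmx_block !(mulmx1, mul1mx, mulmx0, mulmxN, add0r, subrr) det_ublock
             det1 mulr1.
rewrite -detK -[in LHS](det_scalar n) -[X in X * _]mul1r -(det1 _ m) -(det_lblock _ (- v)).
rewrite -det_mulmx mulmx_block !(mulmx1, mul1mx, mul0mx, addr0).
by rewrite mulNmx scalar_mxC addNr mulNmx det_ublock det_scalar (addrC (- _)).
Qed.

Lemma horner_char_poly (R : comNzRingType) (n : nat) (M : 'M[R]_n) (x : R) :
  (char_poly M).[x] = \det (x%:M - M).
Proof.
rewrite -[LHS]/(horner_eval x _) /char_poly -det_map_mx; congr (\det _).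
by apply/matrixP => i j; rewrite !mxE rmorphB rmorphMn /= /horner_eval hornerX hornerC.
Qed.

Lemma poly_eq_nonzero (R : numDomainType) (p q : {poly R}) :
  (forall x, x != 0 -> p.[x] = q.[x]) -> p = q.
Proof.
move=> pq; apply/eqP; rewrite -subr_eq0; apply/eqP.
apply: (@roots_geq_poly_eq0 _ _ [seq i.+1%:R | i <- iota 0 (size (p - q))]).
- by apply/allP => _ /mapP[i _ ->]; rewrite rootE !hornerE pq ?subrr // pnatr_eq0.
- by rewrite map_inj_uniq ?iota_uniq // => i j /eqP; rewrite eqr_nat => /eqP[].
- by rewrite size_map size_iota.
Qed.

(** Where [x] is not zero, [M (x - N) = x M - c = - x (c / x - M)]: the value at [x]
    of the second characteristic polynomial is determined by the value at [c / x] of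
    the first, and the values away from 0 determine a polynomial. *)
Lemma char_poly_scalar_inverse (F : numFieldType) (n : nat) (M N : 'M[F]_n) (c : F)
    (s : seq F) :
  M *m N = c%:M -> 0 \notin s -> char_poly M = \prod_(l <- s) ('X - l%:P) ->
  char_poly N = \prod_(l <- [seq c / l | l <- s]) ('X - l%:P).
Proof.
move=> MN s0 pM.
have size_s : size s = n.
  by have := size_char_poly M; rewrite pM size_prod_XsubC => -[].
have nz l : l \in s -> l != 0 by move=> ls; apply: contraNneq s0 => <-.
have detM : \det M = \prod_(l <- s) l.
  have := char_poly_det M.
  by rewrite pM coef0_prod_XsubC size_s => /lreg_sign.
have detM0 : \det M != 0.
  by rewrite detM prodf_seq_neq0; apply/allP => l /nz.
apply: poly_eq_nonzero => x x0; rewrite horner_char_poly.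
apply: (mulfI detM0); rewrite -det_mulmx mulmxBr MN.
have -> : M *m x%:M - c%:M = (- x) *: ((c / x)%:M - M).
  rewrite mul_mx_scalar scalerBr scale_scalar_mx mulNr mulrC divfK //.
  by rewrite scaleNr opprK addrC raddfN.
rewrite detZ -horner_char_poly pM detM big_map !horner_prod -size_s.
elim: s nz {s0 pM size_s detM detM0} => [|l s IHs] nz; first by rewrite !big_nil expr0.
have l0 := nz l (mem_head _ _).
rewrite !big_cons /= exprS mulrACA IHs => [|k ks]; last by rewrite nz ?inE ?ks ?orbT.
rewrite !hornerXsubC [RHS]mulrACA; congr (_ * _).
by field; rewrite x0 l0.
Qed.

(** * Roots with multiplicity *)

Lemma prod_XsubC_dvd (F : fieldType) (p : {poly F}) (s : seq F) :
  p != 0 -> (forall x, (count_mem x s <= mup x p)%N) ->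
  \prod_(x <- s) ('X - x%:P) %| p.
Proof.
elim: s p => [|y s IHs] p p0 sp; first by rewrite big_nil dvd1p.
have : 'X - y%:P %| p by rewrite XsubC_dvd //; apply: leq_trans (sp y); rewrite /= eqxx.
case/dvdpP => q def_p; rewrite def_p in p0 sp *.
have [q0 _] : q != 0 /\ 'X - y%:P != 0 by apply/andP; rewrite -negb_or -mulf_eq0.
rewrite big_cons mulrC dvdp_mul2r ?polyXsubC_eq0 //; apply: IHs => // x.
have := sp x; rewrite mupM ?polyXsubC_eq0 // (@mup_XsubCX _ 1) /=.
by case: eqP => _; rewrite /= ?addn0 // addnC leq_add2r.
Qed.

(** Since [s] has as many entries as the degree of [p], having the right
    multiplicities away from 0 already determines [p]: no room is left for
    the root 0. *)
Lemma nonzero_roots_mulX (R : realType) (n : nat) (p : {poly R}) (s : n.-tuple R) :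
  p \is monic -> size p = n.+1 ->
  nonzero_roots ('X * p) s <-> 0 \notin s /\ p = \prod_(l <- s) ('X - l%:P).
Proof.
move=> p_monic size_p.
have mupX x : x != 0 -> mup x ('X * p) = mup x p.
  by move=> x0; rewrite mupMr // rootX.
split=> [[s0 s_count]|[s0 ->]]; split=> //.
- apply/esym/eqP; rewrite -eqp_monic ?monic_prod_XsubC // -dvdp_size_eqp.
    by rewrite size_prod_XsubC size_tuple size_p.
  apply: prod_XsubC_dvd => [|x]; first exact: monic_neq0.
  have [->|x0] := eqVneq x 0; first by rewrite (count_memPn s0).
  by rewrite s_count // mupX.
- by move=> x x0; rewrite mupMr ?rootX // mu_prod_XsubC.
Qed.

(** * Stresses and the product of dual forms *)

Definition affinely_spanning (F : fieldType) (m n : nat) (A : 'M[F]_(m, n)) : Prop :=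
  forall (x : 'cV[F]_n) (t : F), A *m x = const_mx t -> x = 0.

(** Unlike a 1-stress, an affine dependence may have zero entries. *)
Definition affine_dependence (F : fieldType) (m n : nat) (A : 'M[F]_(m, n))
    (a : 'rV[F]_m) : Prop :=
  a *m A = 0 /\ a *m (const_mx 1 : 'cV_m) = 0.

Definition stress_form (F : fieldType) (m n : nat) (A : 'M[F]_(m, n))
    (a : 'rV[F]_m) : 'M[F]_n :=
  A^T *m diag_mx a *m A.

Lemma const_mx1_mul_diag (F : fieldType) (m : nat) (a : 'rV[F]_m) :
  (const_mx 1 : 'rV_m) *m diag_mx a = a.
Proof. by apply/rowP => j; rewrite mul_mx_diag !mxE mul1r. Qed.

Lemma stress_weighted_ones (F : fieldType) (m n : nat) (A : 'M[F]_(m, n)) (a : 'rV[F]_m) :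
  affine_dependence A a -> A^T *m diag_mx a *m (const_mx 1 : 'cV_m) = 0.
Proof.
case=> aA _; apply: trmx_inj; rewrite !trmx_mul trmxK tr_diag_mx trmx_const trmx0.
by rewrite mulmxA const_mx1_mul_diag.
Qed.

(** The decomposition of [A *m B^T] is what duality provides.  Between the weighted
    matrices [A^T *m diag_mx a] and [diag_mx b *m B] its two rank one terms vanish,
    as both annihilate the constant vectors; only the diagonal part survives. *)
Lemma stress_form_mul (F : fieldType) (m n : nat) (A B : 'M[F]_(m, n))
    (a b e : 'rV[F]_m) (u : 'cV[F]_m) (v : 'rV[F]_m) :
  affinely_spanning B -> affine_dependence A a -> affine_dependence B b ->
  A *m B^T = u *m const_mx 1 + const_mx 1 *m v + diag_mx e ->
  exists c, stress_form A a *m stress_form B b = c%:M.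
Proof.
move=> spanB stressA [bB b1] AB; have [aA a1] := stressA.
have BA : B *m A^T = const_mx 1 *m u^T + v^T *m const_mx 1 + diag_mx e.
  by rewrite -[LHS]trmxK trmx_mul trmxK AB !linearD /= !trmx_mul !trmx_const tr_diag_mx.
(* [a] annihilates [A *m B^T] and the column of ones, so multiplying the
   decomposition by [a] leaves only [a *m u] and the entries [a_i * e_i]. *)
have [k ke] : exists k, diag_mx a *m diag_mx e = k%:M.
  exists (- (a *m u) 0 0).
  have : a *m (A *m B^T) = 0 by rewrite mulmxA aA mul0mx.
  rewrite AB !mulmxDr !mulmxA a1 mul0mx addr0 => /rowP ae.
  rewrite mulmx_diag; apply/matrixP => i j; rewrite !mxE; congr (_ *+ _).
  have := ae i; rewrite [a *m u]mx11_scalar mul_scalar_mx mul_mx_diag !mxE mulr1.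
  by move/eqP; rewrite addrC addr_eq0 => /eqP.
have [k' ke'] : exists k', diag_mx e *m diag_mx b = k'%:M.
  exists (- (b *m v^T) 0 0).
  have : b *m (B *m A^T) = 0 by rewrite mulmxA bB mul0mx.
  rewrite BA !mulmxDr !mulmxA b1 mul0mx add0r => /rowP be.
  rewrite mulmx_diag; apply/matrixP => i j; rewrite !mxE; congr (_ *+ _).
  have := be i; rewrite [b *m v^T]mx11_scalar mul_scalar_mx mul_mx_diag !mxE mulr1.
  by move/eqP; rewrite addrC addr_eq0 mulrC => /eqP.
have onesbB : (const_mx 1 : 'rV_m) *m diag_mx b *m B = 0.
  by rewrite const_mx1_mul_diag.
have aones := stress_weighted_ones stressA.
(* [B] times the difference has constant columns, which the spanning hypothesis
   turns into zero columns. *)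
have mixed : A^T *m diag_mx b *m B = k'%:M.
  apply/eqP; rewrite -subr_eq0; apply/eqP/matrixP => i j.
  set Y := _ - _.
  have : B *m Y = const_mx 1 *m (u^T *m diag_mx b *m B).
    rewrite mulmxBr !mulmxA BA !mulmxDl ke' -!mulmxA (mulmxA (const_mx 1 : 'rV_m)).
    by rewrite onesbB mulmx0 addr0 mul_scalar_mx mul_mx_scalar addrK.
  move=> /(congr1 (fun Z => col j Z)); rewrite !colE -!mulmxA -colE => BY.
  suff /colP/(_ i) : col j Y = 0 by rewrite !mxE.
  apply: spanB (etrans BY _).
  by rewrite [X in _ *m X]mx11_scalar mul_mx_scalar scalemx_const mulr1.
exists (k * k'); rewrite /stress_form -!mulmxA [A *m _]mulmxA AB !mulmxDl !mulmxDr.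
rewrite -!mulmxA (mulmxA (const_mx 1 : 'rV_m)) onesbB !mulmx0 add0r.
rewrite (mulmxA (diag_mx a) (diag_mx e)) ke mul_scalar_mx -scalemxAr.
rewrite [X in X + _]mulmxA [X in X + _]mulmxA aones mul0mx add0r mulmxA mixed.
by rewrite scale_scalar_mx.
Qed.

(** The orthogonality relations are those of an additive function of [i] and [j],
    restricted to the pairs off the diagonal.  Away from two reference indices [a]
    and [b], row [b] and column [a] give the two summands; the summands at [a]
    and at [b] are read off through a third index [c], and their agreement with the
    entry in row [a] and column [b] uses a fourth index [d]. *)
Lemma off_diagonal_decomposition (F : fieldType) (m : nat) (N : 'M[F]_m) :
  (4 <= m)%N ->
  (forall i j k l, uniq [:: i; j; k; l] -> N j l - N j k - N i l + N i k = 0) ->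
  exists (u : 'cV[F]_m) (v e : 'rV[F]_m),
    N = u *m const_mx 1 + const_mx 1 *m v + diag_mx e.
Proof.
move=> m4 N4.
suff [u [v uv]] : exists u v : 'I_m -> F, forall i j, i != j -> N i j = u i + v j.
  exists (\col_i u i), (\row_j v j), (\row_i (N i i - u i - v i)).
  apply/matrixP => i j; rewrite !mxE !big_ord1 !mxE mulr1 mul1r.
  have [->|/uv ->] := eqVneq i j; last by rewrite addr0.
  by rewrite mulr1n; ring.
have [a [b [c [d]]]] : exists a b c d : 'I_m, uniq [:: a; b; c; d].
  exists (Ordinal (leq_trans (isT : 0 < 4)%N m4)), (Ordinal (leq_trans (isT : 1 < 4)%N m4)).
  by exists (Ordinal (leq_trans (isT : 2 < 4)%N m4)), (Ordinal (leq_trans (isT : 3 < 4)%N m4)).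
rewrite /= !inE !negb_or -!andbA => /and5P[ab ac ad bc /and3P[bd cd _]].
have N4' i j k l : i != j -> i != k -> i != l -> j != k -> j != l -> k != l ->
    N j l = N j k + N i l - N i k.
  move=> ij ik il jk jl kl; apply/eqP; rewrite -subr_eq0; apply/eqP.
  rewrite -[RHS](N4 i j k l); first by ring.
  by rewrite /= !inE !negb_or ij ik il jk jl kl.
pose v j := if j == b then N c b - N c a else if j == a then 0 else N b j - N b a.
pose u i := if i == a then N a c - v c else N i a.
have ca : c == a = false by rewrite eq_sym (negPf ac).
have cb : c == b = false by rewrite eq_sym (negPf bc).
exists u, v => i j ij; rewrite /u /v.
have [jb|jb] := eqVneq j b; have [ia|ia] := eqVneq i a; rewrite ?cb ?ca.
- rewrite ia jb (N4' c a d b) 1?(N4' b a c d) 1?(N4' b c a d) // 1?eq_sym //.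
  by ring.
- rewrite jb; have [->|ic] := eqVneq i c; first by ring.
  by rewrite (N4' c i a b) ?ca ?cb //; [ring | rewrite eq_sym | rewrite -jb].
- have [ja|ja] := eqVneq j a; first by rewrite ia ja eqxx in ij.
  have [->|jc] := eqVneq j c; first by rewrite ia; ring.
  by rewrite ia (N4' b a c j) // 1?eq_sym //; ring.
- have [->|ja] := eqVneq j a; first by rewrite addr0.
  have [->|ib] := eqVneq i b; first by ring.
  by rewrite (N4' b i a j) // 1?eq_sym //; ring.
Qed.

(** * Simplices *)

Definition point_matrix (R : nmodType) (m n : nat) (A : 'I_m -> 'rV[R]_n) : 'M[R]_(m, n) :=
  \matrix_i A i.

Lemma row_mul_points (R : pzRingType) (m n : nat) (w : 'rV[R]_m) (A : 'I_m -> 'rV[R]_n) :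
  w *m point_matrix A = \sum_i w 0 i *: A i.
Proof. by rewrite mulmx_sum_row; apply: eq_bigr => i _; rewrite rowK. Qed.

Lemma row_mul_ones (R : pzRingType) (m : nat) (w : 'rV[R]_m) :
  w *m (const_mx 1 : 'cV_m) = (\sum_i w 0 i)%:M.
Proof.
rewrite [LHS]mx11_scalar mxE; congr (_%:M).
by apply: eq_bigr => i _; rewrite mxE mulr1.
Qed.

Lemma one_stress_dependence (R : realType) (n : nat) (A : 'I_n.+2 -> 'rV[R]_n)
    (alpha : 'I_n.+2 -> R) :
  one_stress A alpha -> affine_dependence (point_matrix A) (\row_i alpha i).
Proof.
case=> _ sA s1; split.
  by rewrite row_mul_points -[RHS]sA; apply: eq_bigr => i _; rewrite mxE.
rewrite row_mul_ones (eq_bigr alpha) => [|i _]; last by rewrite mxE.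
by rewrite s1 raddf0.
Qed.

(** A dependence vanishing at the first vertex is one of the [n + 1] other vertices,
    which are affinely independent. *)
Lemma degenerate_simplex_dependence0 (R : realType) (n : nat) (A : 'I_n.+2 -> 'rV[R]_n)
    (w : 'rV[R]_n.+2) :
  degenerate_simplex A -> affine_dependence (point_matrix A) w -> w 0 0 = 0 -> w = 0.
Proof.
move=> genA [wA w1] w0.
have cardS : #|~: [set ord0 : 'I_n.+2]| = n.+1 by rewrite cardsC1 card_ord.
have drop0 (V : zmodType) (f : 'I_n.+2 -> V) :
    f ord0 = 0 -> \sum_(i in ~: [set ord0 : 'I_n.+2]) f i = \sum_i f i.
  move=> f0; rewrite [RHS](bigD1 ord0) //= f0 add0r.
  by apply: eq_bigl => i; rewrite !inE.
apply/rowP => i; rewrite [RHS]mxE; have [->//|i0] := eqVneq i ord0.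
apply: (genA _ cardS (w 0)); last by rewrite !inE.
  rewrite drop0 //; move: w1; rewrite row_mul_ones => /matrixP/(_ 0 0).
  by rewrite !mxE mulr1n.
by rewrite drop0 ?w0 ?scale0r // -row_mul_points.
Qed.

(** Dropping the first vertex and adding a column of ones gives a square matrix with
    independent rows, hence invertible: an affine function vanishing at the remaining
    vertices is zero. *)
Lemma degenerate_simplex_spanning (R : realType) (n : nat) (A : 'I_n.+2 -> 'rV[R]_n) :
  degenerate_simplex A -> affinely_spanning (point_matrix A).
Proof.
move=> genA x t Ax.
pose H : 'M[R]_(n.+1, 1 + n) :=
  row_mx (const_mx 1 : 'cV_n.+1) (rowsub (lift ord0) (point_matrix A)).
have H_free : row_free H.
  apply/inj_row_free => v; rewrite /H mul_mx_row => vH.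
  have [v1 vA] := eq_row_mx (etrans vH (esym (row_mx0 _ _ _ _))).
  pose w : 'rV[R]_n.+2 := \row_i oapp (v 0) 0 (unlift ord0 i).
  have w_tail p (C : 'M[R]_(n.+2, p)) : w *m C = v *m rowsub (lift ord0) C.
    apply/rowP => j; rewrite !mxE big_ord_recl !mxE unlift_none mul0r add0r.
    by apply: eq_bigr => i _; rewrite !mxE liftK.
  have /rowP w0 : w = 0.
    apply: (degenerate_simplex_dependence0 genA); last by rewrite mxE unlift_none.
    split; rewrite w_tail //; apply: etrans v1; congr (_ *m _).
    by apply/colP => i; rewrite !mxE.
  by apply/rowP => i; have := w0 (lift ord0 i); rewrite !mxE liftK.
have H_unit : (H : 'M_n.+1) \in unitmx by rewrite -row_free_unit.
have : H *m col_mx (const_mx (- t) : 'M_1) x = 0.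
  rewrite /H mul_row_col mul_rowsub_mx Ax; apply/colP => i.
  by rewrite !mxE big_ord1 !mxE mul1r addNr.
move/(congr1 (mulmx (invmx H))); rewrite mulKmx // mulmx0 => tx0.
by have := congr1 (@dsubmx R 1 n 1) tx0; rewrite col_mxKd linear0.
Qed.

(** If [x] is in the kernel then the products of [alpha_i] with [A_i . x] are an affine
    dependence, hence proportional to [alpha]: [A_i . x] does not depend on [i], and
    [x = 0] because the vertices span. *)
Lemma stress_form_unit (R : realType) (n : nat) (A : 'I_n.+2 -> 'rV[R]_n)
    (alpha : 'I_n.+2 -> R) :
  degenerate_simplex A -> one_stress A alpha ->
  stress_form (point_matrix A) (\row_i alpha i) \in unitmx.
Proof.
move=> genA sA; have [nz _ _] := sA; have [aA a1] := one_stress_dependence sA.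
rewrite -unitmx_tr -row_free_unit; apply/inj_row_free => x.
rewrite /stress_form !trmx_mul trmxK tr_diag_mx !mulmxA => xM.
set a := \row_i alpha i in aA a1 xM.
pose y := x *m (point_matrix A)^T.
have y_dep : affine_dependence (point_matrix A) (y *m diag_mx a).
  by split=> //; rewrite /y -!mulmxA [_ *m (_ *m const_mx 1)]mulmxA
                        stress_weighted_ones ?mulmx0.
have eq_y : y *m diag_mx a - y 0 0 *: a = 0.
  apply: (degenerate_simplex_dependence0 genA).
    by case: y_dep => yA y1; split; rewrite mulmxBl -scalemxAl ?yA ?y1 ?aA ?a1 scaler0 subr0.
  by rewrite mul_mx_diag !mxE subrr.
apply: trmx_inj; rewrite trmx0; apply: (degenerate_simplex_spanning genA (t := y 0 0)).
rewrite -[point_matrix A]trmxK -trmx_mul -/y; apply/colP => i.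
move/rowP/(_ i): eq_y; rewrite mul_mx_diag !mxE -mulrBl => /eqP.
by rewrite mulf_eq0 (negPf (nz i)) orbF subr_eq0 => /eqP.
Qed.

(** The form does not see the base points, since a translation changes [A] by a
    matrix with constant columns, which the weights annihilate. *)
Lemma stress_form_translate (F : fieldType) (m n : nat) (A : 'M[F]_(m, n))
    (a : 'rV[F]_m) (P Q : 'rV[F]_n) :
  affine_dependence A a ->
  (A - const_mx 1 *m Q)^T *m (diag_mx a *m (A - const_mx 1 *m P)) = stress_form A a.
Proof.
move=> stressA; have [aA a1] := stressA; have ones_a := const_mx1_mul_diag a.
rewrite linearB /= trmx_mul trmx_const mulmxBl -mulmxA [const_mx 1 *m (_ *m _)]mulmxA ones_a.
rewrite !mulmxBr aA [a *m (_ *m P)]mulmxA a1 mul0mx mulmx0 subrr subr0.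
by rewrite !mulmxA stress_weighted_ones // mul0mx subr0.
Qed.

Lemma stress_char_polyE (R : realType) (n : nat) (A : 'I_n.+2 -> 'rV[R]_n)
    (alpha : 'I_n.+2 -> R) (P Q : 'rV[R]_n) :
  one_stress A alpha ->
  stress_char_poly A alpha P Q =
    'X * char_poly (stress_form (point_matrix A) (\row_i alpha i)).
Proof.
move=> sA; set a := \row_i alpha i; set M := stress_form _ _.
pose U := diag_mx a *m (point_matrix A - const_mx 1 *m P).
pose V := (point_matrix A - const_mx 1 *m Q)^T.
have chiE : char_poly (U *m V) = 'X^2 * char_poly M.
  have := char_poly_mulmxC U V; rewrite [V *m U]stress_form_translate; last first.
    exact: one_stress_dependence.
  have -> : 'X^(n.+2) = 'X^n * 'X^2 :> {poly R} by rewrite -exprD addn2.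
  rewrite -mulrA; apply: mulfI.
  by rewrite expf_neq0 // polyX_eq0.
have minorE (S : {set 'I_n.+2}) : \det (principal_submx S (U *m V)) =
    (\prod_(s in S) alpha s) * \det (\matrix_(i < #|S|, j < #|S|)
            dot (A (enum_val i) - P) (A (enum_val j) - Q)).
  rewrite big_enum_val; set G := \matrix_(i, j) _.
  have -> : principal_submx S (U *m V) = diag_mx (\row_i alpha (enum_val i)) *m G.
    rewrite /U -mulmxA !mul_diag_mx; apply/matrixP => i j; rewrite !mxE; congr (_ * _).
    by apply: eq_bigr => h _; rewrite !mxE !big_ord1 !mxE !mul1r.
  rewrite det_mulmx det_diag; congr (_ * _).
  by apply: eq_bigr => i _; rewrite mxE.
have chi_sum : char_poly (U *m V) =
    'X * stress_char_poly A alpha P Q + ((-1) ^+ n.+2 * stress_inv A alpha P Q n.+2)%:P.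
  rewrite char_poly_principal_minors.
  have cardS (S : {set 'I_n.+2}) : (#|S| < n.+3)%N.
    by rewrite ltnS (leq_trans (max_card _)) // card_ord.
  rewrite (partition_big (fun S => Ordinal (cardS S)) predT) //=.
  have sizeE (k : 'I_n.+3) : \sum_(S : {set 'I_n.+2} | Ordinal (cardS S) == k)
      ((-1) ^+ #|S| * \det (principal_submx S (U *m V))) *: 'X^(n.+2 - #|S|) =
      ((-1) ^+ k * stress_inv A alpha P Q k) *: 'X^(n.+2 - k).
    rewrite /stress_inv mulr_sumr scaler_suml; apply: eq_big => [S|S /eqP <-] //.
    by rewrite minorE.
  rewrite (eq_bigr _ (fun k _ => sizeE k)) big_ord_recr /= subnn expr0 alg_polyC.
  congr (_ + _); rewrite mulr_sumr; apply: eq_bigr => k _ /=.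
  by rewrite -scalerAr -exprS subSn // -ltnS.
have X0 : 'X != 0 :> {poly R} by rewrite polyX_eq0.
(* The sum over all principal minors has one more term than the stress polynomial;
   comparing values at 0 shows that it vanishes. *)
have top0 : (-1) ^+ n.+2 * stress_inv A alpha P Q n.+2 = 0.
  have := congr1 (fun p : {poly R} => p.[0]) chi_sum.
  by rewrite chiE hornerD !hornerM hornerX hornerC !mul0r add0r => <-.
by apply: (mulfI X0); rewrite mulrA -expr2 -chiE chi_sum top0 addr0.
Qed.

(** * Duality inverts the spectrum *)

Theorem theorem1p4 (R : realType) (n : nat) (hn : (2 <= n)%N)
    (A B : 'I_n.+2 -> 'rV[R]_n)
    (hA : degenerate_simplex A) (hAB : dual A B)
    (alpha beta : 'I_n.+2 -> R)
    (halpha : one_stress A alpha) (hbeta : one_stress B beta)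
    (P Q P' Q' : 'rV[R]_n) (lambda : n.-tuple R)
    (hlambda : nonzero_roots (stress_char_poly A alpha P Q) lambda) :
  exists c : R,
    nonzero_roots (stress_char_poly B beta P' Q') [seq c / l | l <- lambda].
Proof.
have [genB orth] := hAB.
move: hlambda; rewrite !stress_char_polyE //.
set M := stress_form _ _ => /nonzero_roots_mulX[].
- exact: char_poly_monic.
- exact: size_char_poly.
move=> lambda0 charM.
have [u [v [e AB]]] : exists (u : 'cV[R]_n.+2) (v e : 'rV[R]_n.+2),
    point_matrix A *m (point_matrix B)^T = u *m const_mx 1 + const_mx 1 *m v + diag_mx e.
  apply: off_diagonal_decomposition => // i j k l ijkl.
  rewrite -[RHS](orth i j k l ijkl) /dot !mxE -!sumrB -!big_split /=.
  by apply: eq_bigr => h _; rewrite !mxE; ring.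
have [c MN] := stress_form_mul (degenerate_simplex_spanning genB)
  (one_stress_dependence halpha) (one_stress_dependence hbeta) AB.
exists c; set N := stress_form (point_matrix B) _ in MN *.
have charN := char_poly_scalar_inverse MN lambda0 charM.
(* The product of the determinants of the two forms is [c ^+ n]. *)
have c0 : c != 0.
  have detM0 : \det M != 0.
    have := char_poly_det M; rewrite charM coef0_prod_XsubC size_tuple => /lreg_sign <-.
    rewrite prodf_seq_neq0; apply/allP => l ls /=.
    by apply: contraNneq lambda0 => <-.
  have detN0 : \det N != 0.
    by rewrite -unitfE -unitmxE; apply: stress_form_unit.
  have := congr1 determinant MN; rewrite det_mulmx det_scalar => /eqP.
  apply: contraTneq => ->.
  by rewrite expr0n (negPf (lt0n_neq0 (ltnW hn))) mulf_neq0.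
apply/(nonzero_roots_mulX (map_tuple (fun l => c / l) lambda)).
- exact: char_poly_monic.
- exact: size_char_poly.
split=> //; apply/mapP => -[l ls /eqP].
rewrite eq_sym mulf_eq0 (negPf c0) invr_eq0 => /eqP l0.
by rewrite -l0 ls in lambda0.
Qed.
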